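(* Let $E$ be a truncated Riesz space, and let $E\oplus\mathbb{R}$ be its unitization. (1) If $E$ is laterally complete, then $E\oplus\mathbb{R}$ is laterally complete. (2) Suppose $E\oplus\mathbb{R}$ is laterally complete and Archimedean. Then $E$ is laterally complete if and only if $E$ is unital.
   Context: A truncation on a (real) Riesz space $E$ is a map $x\mapsto\bar{x}$ from the positive cone $E^{+}$ into itself such that for all $a,b\in E^{+}$: $(\tau_1)$ $a\wedge\bar{b}\leq\bar{a}\leq a$; $(\tau_2)$ $\bar{a}=0$ implies $a=0$. A truncated Riesz space is a Riesz space $E$ equipped with a truncation. It is called unital if there exists $u\in E^{+}$ (the truncation unit) such that $\bar{x}=x\wedge u$ for all $x\in E^{+}$. The set of fixed points is $\bar{E}=\{x\in E:\overline{|x|}=|x|\}$. The unitization $E\oplus\mathbb{R}=\{x+\lambda: x\in E,\lambda\in\mathbb{R}\}$ is the vector space $E\times\mathbb{R}$ (with $E$ identified with $E\times\{0\}$ and $\mathbb{R}$ with $\{0\}\times\mathbb{R}$, so $1=(0,1)$), ordered by the positive cone $(E\oplus\mathbb{R})^{+}=E^{+}\cup\{x+\lambda: x\in E,\ \lambda\in\mathbb{R},\ \lambda>0,\ \tfrac{1}{\lambda}x^{-}\in\bar{E}\}$. It is known that $E\oplus\mathbb{R}$ is a Riesz space, that $E$ is a vector sublattice (indeed a maximal ideal) of it, and that $\bar{x}=x\wedge 1$ for all $x\in E^{+}$. This space is used whether or not $E$ is unital. A Riesz space is said to be laterally complete if every disjoint family of positive elements that is bounded above admits a supremum.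
   Formalization: ''Laterally complete'' is taken in the standard sense: every (nonempty) disjoint family of positive elements has a supremum, without the clause ''that is bounded above''; with that clause (1) fails for finitely supported sequences and (2) fails for a free maximal ideal of l^infty. *)

(* Defs.v *)
From HB Require Import structures.
From mathcomp Require Import all_boot all_order all_algebra.
From mathcomp Require Import classical_sets reals.

Set Implicit Arguments.
Unset Strict Implicit.
Unset Printing Implicit Defensive.

Import Order.TTheory GRing.Theory Num.Theory.
Local Open Scope ring_scope.

(* [Order.Lattice ring_display] cannot be joined with [GRing.Zmodule] after   *)
(* the numeric hierarchy has been declared, so the lattice operations are     *)
(* fields of the mixin, with the axioms of [POrder_MeetJoin_isLattice].       *)
HB.mixin Record Lmodule_POrder_isRiesz (R : realType) E
    of GRing.Lmodule R E & Num.POrderedZmodule E := {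
  rmeet : E -> E -> E;
  rjoin : E -> E -> E;
  rlexI : forall x y z : E, (x <= rmeet y z) = (x <= y) && (x <= z);
  rleUx : forall x y z : E, (rjoin x y <= z) = (x <= z) && (y <= z);
  riesz_lerD2r : forall z x y : E, x <= y -> x + z <= y + z;
  riesz_scaler_ge0 : forall (a : R) (x : E), 0 <= a -> 0 <= x -> 0 <= a *: x
}.

#[short(type="rieszType")]
HB.structure Definition Riesz (R : realType) :=
  { E of GRing.Lmodule R E & Num.POrderedZmodule E
       & Lmodule_POrder_isRiesz R E }.

(* The truncation is a map from the positive cone to itself; it is encoded as *)
(* a total function whose values outside the positive cone are irrelevant.    *)
HB.mixin Record Riesz_hasTruncation (R : realType) E of Riesz R E := {
  trunc : E -> E;
  trunc_ge0 : forall a : E, 0 <= a -> 0 <= trunc a;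
  trunc_meet : forall a b : E, 0 <= a -> 0 <= b ->
    (rmeet a (trunc b) <= trunc a) && (trunc a <= a);
  trunc_eq0 : forall a : E, 0 <= a -> trunc a = 0 -> a = 0
}.

#[short(type="truncRieszType")]
HB.structure Definition TruncRiesz (R : realType) :=
  { E of Riesz R E & Riesz_hasTruncation R E }.

Definition rneg (R : realType) (E : rieszType R) (x : E) : E := rjoin (- x) 0.

Definition rabs (R : realType) (E : rieszType R) (x : E) : E := rjoin x (- x).

Definition fixpt (R : realType) (E : truncRieszType R) (x : E) : bool :=
  trunc (rabs x) == rabs x.

Definition unital (R : realType) (E : truncRieszType R) : Prop :=
  exists2 u : E, 0 <= u & forall x : E, 0 <= x -> trunc x = rmeet x u.

Definition riesz_archimedean (R : realType) (E : rieszType R) : Prop :=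
  forall x y : E, 0 <= x -> 0 <= y -> (forall n : nat, x *+ n <= y) -> x = 0.

(* The standard notion: the family need not be bounded above. If only bounded *)
(* families were required to have suprema, the space c00 of finitely          *)
(* supported sequences, truncated by x |-> x /\ 1, would qualify, whereas its *)
(* unitization, the eventually constant sequences, would not: the unit        *)
(* vectors of even index have the upper bound 1 but no supremum. The family   *)
(* is nonempty, as the empty one has no supremum in a nonzero Riesz space.    *)
Definition laterally_complete (R : realType) (E : rieszType R) : Prop :=
  forall (I : Type) (x : I -> E), inhabited I ->
    (forall i, 0 <= x i) ->
    (forall i j, i <> j -> rmeet (x i) (x j) = 0) ->
    (supremums (range x) !=set0)%classic.

Section RieszTheory.
Variables (R : realType) (E : rieszType R).
Implicit Types (x y z a b c r : E) (l m : R).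

Lemma rleIl x y : rmeet x y <= x.
Proof. by have := lexx (rmeet x y); rewrite rlexI => /andP[]. Qed.

Lemma rleIr x y : rmeet x y <= y.
Proof. by have := lexx (rmeet x y); rewrite rlexI => /andP[]. Qed.

Lemma rleUl x y : x <= rjoin x y.
Proof. by have := lexx (rjoin x y); rewrite rleUx => /andP[]. Qed.

Lemma rleUr x y : y <= rjoin x y.
Proof. by have := lexx (rjoin x y); rewrite rleUx => /andP[]. Qed.

Lemma rlerD2r z x y : (x + z <= y + z) = (x <= y).
Proof.
apply/idP/idP; last exact: riesz_lerD2r.
by move/(@riesz_lerD2r _ _ (- z)); rewrite !addrK.
Qed.

Lemma rlerD2l z x y : (z + x <= z + y) = (x <= y).
Proof. by rewrite ![z + _]addrC rlerD2r. Qed.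

Lemma rlerD a b x y : a <= b -> x <= y -> a + x <= b + y.
Proof.
by move=> ab xy; apply: (@le_trans _ _ (b + x)); rewrite ?rlerD2r ?rlerD2l.
Qed.

Lemma raddr_ge0 x y : 0 <= x -> 0 <= y -> 0 <= x + y.
Proof. by move=> x0 y0; rewrite -[0]addr0; apply: rlerD. Qed.

Lemma rsubr_ge0 x y : (0 <= y - x) = (x <= y).
Proof. by rewrite -(rlerD2r x 0) add0r subrK. Qed.

Lemma rlerBlDr x y z : (x - y <= z) = (x <= z + y).
Proof. by rewrite -(rlerD2r y (x - y)) subrK. Qed.

Lemma rlerN2 x y : (- x <= - y) = (y <= x).
Proof. by rewrite -(rsubr_ge0 y) -rsubr_ge0 opprK addrC. Qed.

Lemma roppr_le0 x : (- x <= 0) = (0 <= x).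
Proof. by rewrite -[in LHS]oppr0 rlerN2. Qed.

Lemma rlerZ l x y : 0 <= l -> x <= y -> l *: x <= l *: y.
Proof.
move=> l0; rewrite -rsubr_ge0 => xy.
by rewrite -rsubr_ge0 -scalerBr riesz_scaler_ge0.
Qed.

Lemma rlerZ_pos l x y : 0 < l -> (l *: x <= l *: y) = (x <= y).
Proof.
move=> l0; apply/idP/idP; last by apply: rlerZ; apply: ltW.
move/(@rlerZ l^-1 _ _ _); rewrite !scalerK ?gt_eqF//.
by apply; rewrite invr_ge0 ltW.
Qed.

Lemma rmeetZ l x y : 0 < l -> rmeet (l *: x) (l *: y) = l *: rmeet x y.
Proof.
move=> l0; apply/le_anti/andP; split; last first.
  by rewrite rlexI !rlerZ_pos// rleIl rleIr.
have ln0 : l != 0 by rewrite gt_eqF.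
rewrite -[X in X <= _](scalerKV ln0) rlerZ_pos// rlexI.
by rewrite -(rlerZ_pos _ x l0) -(rlerZ_pos _ y l0) scalerKV// rleIl rleIr.
Qed.

Lemma rmeetD z x y : rmeet (x + z) (y + z) = rmeet x y + z.
Proof.
apply/le_anti/andP; split; last by rewrite rlexI !rlerD2r rleIl rleIr.
by rewrite -rlerBlDr rlexI !rlerBlDr rleIl rleIr.
Qed.

Lemma rneg_ge0 x : 0 <= rneg x. Proof. exact: rleUr. Qed.

Lemma rabs_ge0 x : 0 <= rabs x.
Proof.
have h : 0 <= rabs x + rabs x.
  rewrite -(subrr x); apply: rlerD; [exact: rleUl | exact: rleUr].
have -> : rabs x = 2^-1 *: (rabs x + rabs x).
  by rewrite -mulr2n -scaler_nat scalerA mulVf ?scale1r ?pnatr_eq0.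
by apply: riesz_scaler_ge0 => //; rewrite invr_ge0.
Qed.

Lemma rabs_id x : 0 <= x -> rabs x = x.
Proof.
move=> x0; apply/le_anti; rewrite rleUl andbT rleUx lexx/=.
by apply: (@le_trans _ _ 0) => //; rewrite roppr_le0.
Qed.

Lemma rneg_leP x z : (rneg x <= z) = (- x <= z) && (0 <= z).
Proof. by rewrite rleUx. Qed.

Lemma rpos_ge0 x : 0 <= x + rneg x.
Proof. by rewrite -[x in x + _]opprK addrC rsubr_ge0 rleUl. Qed.

Lemma rpos_leP x z : (x + rneg x <= z) = (x <= z) && (0 <= z).
Proof.
rewrite -(rlerD2r (- x) (x + _)) addrAC subrr add0r rneg_leP rsubr_ge0.
by rewrite -(rlerD2r x (- x)) addNr subrK andbC.
Qed.

Lemma rdisjD a b r : 0 <= a -> 0 <= b -> rmeet a r = 0 -> rmeet b r = 0 ->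
  0 <= r -> rmeet (a + b) r = 0.
Proof.
move=> a0 b0 ar br r0; set w := rmeet _ _.
have wr : w <= r by exact: rleIr.
have w0 : 0 <= w by rewrite rlexI raddr_ge0.
have wb : w <= b.
  rewrite -[b]add0r -ar -rlerBlDr rlexI rlerBlDr rleIl/=.
  by rewrite rlerBlDr (le_trans wr)// -[X in X <= _]addr0 rlerD2l.
by apply/le_anti; rewrite w0 andbT -br rlexI wb wr.
Qed.

Lemma rpos_disj x : rmeet (x + rneg x) (rneg x) = 0.
Proof.
apply/le_anti; rewrite rlexI rpos_ge0 rneg_ge0 !andbT.
set w := rmeet _ _.
have h1 : rneg x <= rneg x - w.
  rewrite rneg_leP rsubr_ge0 rleIr andbT -(rlerD2r (w + x) (- x)).
  by rewrite addrCA addNr addr0 addrA subrK [X in _ <= X]addrC rleIl.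
by rewrite -[w <= 0]rlerN2 oppr0 -(rlerD2l (rneg x)) addr0.
Qed.

End RieszTheory.

Section TruncTheory.
Variables (R : realType) (E : truncRieszType R).
Implicit Types (x y z a b c : E) (l m n : R).

Definition dtrunc l x : E := l *: trunc (l^-1 *: x).
Local Notation T := dtrunc.

Lemma fixptP l x : 0 < l -> 0 <= x -> reflect (T l x = x) (fixpt (l^-1 *: x)).
Proof.
move=> l0 x0; have ln0 : l != 0 by rewrite gt_eqF.
rewrite /fixpt rabs_id; last by rewrite riesz_scaler_ge0// invr_ge0 ltW.
rewrite /T; apply: (iffP eqP) => [->|Tx]; first by rewrite scalerKV.
by rewrite -{2}Tx scalerK.
Qed.

Lemma invZ_ge0 l x : 0 < l -> 0 <= x -> 0 <= l^-1 *: x.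
Proof. by move=> l0 x0; rewrite riesz_scaler_ge0// invr_ge0 ltW. Qed.

Lemma dtrunc_ge0 l a : 0 < l -> 0 <= a -> 0 <= T l a.
Proof.
by move=> l0 a0; rewrite riesz_scaler_ge0 ?trunc_ge0 ?invZ_ge0// ltW.
Qed.

Lemma dtrunc_le l a : 0 < l -> 0 <= a -> T l a <= a.
Proof.
move=> l0 a0; rewrite -[X in _ <= X](scalerKV (lt0r_neq0 l0)) rlerZ_pos//.
by have /andP[] := @trunc_meet _ _ (l^-1 *: a) 0 (invZ_ge0 l0 a0) (lexx 0).
Qed.

Lemma dtrunc_meet l a b : 0 < l -> 0 <= a -> 0 <= b ->
  rmeet a (T l b) <= T l a.
Proof.
move=> l0 a0 b0; rewrite -[X in rmeet X _](scalerKV (lt0r_neq0 l0)).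
rewrite rmeetZ// rlerZ_pos//.
by have /andP[] := trunc_meet _ _ (invZ_ge0 l0 a0) (invZ_ge0 l0 b0).
Qed.

Lemma dtrunc_max l a z : 0 < l -> 0 <= a -> 0 <= z -> z <= a -> T l z = z ->
  z <= T l a.
Proof.
move=> l0 a0 z0 za Tz; apply: le_trans (dtrunc_meet l0 a0 z0).
by rewrite Tz rlexI za lexx.
Qed.

Lemma dtrunc_id l a : 0 < l -> 0 <= a -> T l (T l a) = T l a.
Proof.
move=> l0 a0; have Ta0 := dtrunc_ge0 l0 a0.
apply/le_anti; rewrite dtrunc_le//=.
by apply: le_trans (dtrunc_meet l0 Ta0 a0); rewrite rlexI !lexx.
Qed.

Lemma dtrunc_solid l a b : 0 < l -> 0 <= a -> a <= b -> T l b = b -> T l a = a.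
Proof.
move=> l0 a0 ab Tb; have b0 := le_trans a0 ab.
apply/le_anti; rewrite dtrunc_le//=.
by apply: le_trans (dtrunc_meet l0 a0 b0); rewrite Tb rlexI lexx.
Qed.

Lemma dtrunc_join l a b : 0 < l -> 0 <= a -> 0 <= b -> T l a = a -> T l b = b ->
  T l (rjoin a b) = rjoin a b.
Proof.
move=> l0 a0 b0 Ta Tb.
have j0 : 0 <= rjoin a b by apply: le_trans a0 _; exact: rleUl.
apply/le_anti; rewrite dtrunc_le//= rleUx.
by rewrite !dtrunc_max// ?rleUl ?rleUr.
Qed.

Lemma dtruncZ l m a : 0 < l -> 0 < m -> T l a = a ->
  T m ((m / l) *: a) = (m / l) *: a.
Proof.
move=> l0 m0 Ta; rewrite /T scalerA mulKf ?gt_eqF//.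
by rewrite -[in RHS]Ta /T scalerA mulfVK ?gt_eqF.
Qed.

Lemma dtruncD l m a b : 0 < l -> 0 < m -> 0 <= a -> 0 <= b ->
  T l a = a -> T m b = b -> T (l + m) (a + b) = a + b.
Proof.
move=> l0 m0 a0 b0 Ta Tb; have s0 : 0 < l + m by rewrite addr_gt0.
have sn0 := lt0r_neq0 s0.
set a' := ((l + m) / l) *: a; set b' := ((l + m) / m) *: b.
have a'0 : 0 <= a' by rewrite riesz_scaler_ge0// divr_ge0// ltW.
have b'0 : 0 <= b' by rewrite riesz_scaler_ge0// divr_ge0// ltW.
have J : T (l + m) (rjoin a' b') = rjoin a' b'.
  by apply: dtrunc_join => //; apply: dtruncZ.
apply: dtrunc_solid J => //; first exact: raddr_ge0.
have -> : a = (l / (l + m)) *: a'.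
  by rewrite /a' scalerA mulrA divfK// divff ?scale1r ?gt_eqF.
have -> : b = (m / (l + m)) *: b'.
  by rewrite /b' scalerA mulrA divfK// divff ?scale1r ?gt_eqF.
rewrite -[X in _ <= X]scale1r -(divff sn0) [X in X *: rjoin _ _]mulrDl scalerDl.
by apply: rlerD; (apply: rlerZ; first by rewrite divr_ge0// ltW);
  rewrite ?rleUl ?rleUr.
Qed.

Lemma dtrunc_disj l b z : 0 < l -> 0 <= b -> 0 <= z -> T l z = z ->
  rmeet (rjoin (z - T l b) 0) (b - T l b) = 0.
Proof.
move=> l0 b0 z0 Tz; set s := T l b; set q := rmeet _ _.
have s0 : 0 <= s by exact: dtrunc_ge0.
have q0 : 0 <= q by rewrite rlexI rleUr rsubr_ge0 dtrunc_le.
apply/le_anti; rewrite q0 andbT -(rlerD2r s) add0r.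
apply: dtrunc_max => //; first exact: raddr_ge0.
  by rewrite -[s]opprK rlerBlDr rleIr.
apply: (@dtrunc_solid _ _ (rjoin z s)) => //; first exact: raddr_ge0.
  rewrite -[s in q + s]opprK rlerBlDr; apply: le_trans (rleIl _ _) _.
  by rewrite rleUx rlerD2r rleUl rsubr_ge0 rleUr.
by apply: dtrunc_join => //; exact: dtrunc_id.
Qed.

Lemma dtruncB l n b : 0 < l -> 0 < n -> 0 <= b -> T (l + n) b = b ->
  T n (b - T l b) = b - T l b.
Proof.
move=> l0 n0 b0 Tb; set d := b - T l b.
have m0 : 0 < l + n by rewrite addr_gt0.
have d0 : 0 <= d by rewrite rsubr_ge0 dtrunc_le.
set r := d - T n d; have r0 : 0 <= r by rewrite rsubr_ge0 dtrunc_le.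
have rd : r <= d by rewrite -rsubr_ge0 opprB addrC subrK dtrunc_ge0.
set z := (l / (l + n)) *: b; set y := (n / (l + n)) *: b.
have z0 : 0 <= z by rewrite riesz_scaler_ge0// divr_ge0// ltW.
have y0 : 0 <= y by rewrite riesz_scaler_ge0// divr_ge0// ltW.
have Tz : T l z = z by exact: dtruncZ.
have Ty : T n y = y by exact: dtruncZ.
set z' := rjoin (z - T l b) 0; set y' := rjoin (y - T n d) 0.
have z'0 : 0 <= z' by exact: rleUr.
have y'0 : 0 <= y' by exact: rleUr.
have zr : rmeet z' r = 0.
  apply/le_anti; rewrite rlexI z'0 r0 andbT.
  by rewrite -(dtrunc_disj l0 b0 z0 Tz) rlexI rleIl (le_trans (rleIr _ _)).
have yr : rmeet y' r = 0 by exact: dtrunc_disj.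
have rzy : r <= z' + y'.
  have -> : r = (z - T l b) + (y - T n d).
    rewrite addrACA -scalerDl -mulrDl divff ?gt_eqF// scale1r.
    by rewrite addrA.
  by apply: rlerD; exact: rleUl.
have : r = 0.
  rewrite -(rdisjD z'0 y'0 zr yr r0).
  by apply/le_anti; rewrite rleIr rlexI rzy lexx.
by move/eqP; rewrite subr_eq0 => /eqP.
Qed.

End TruncTheory.

Definition unitization (R : realType) (E : truncRieszType R) : Type :=
  (E * R^o)%type.

HB.instance Definition _ (R : realType) (E : truncRieszType R) :=
  GRing.Lmodule.copy (unitization E) (E * R^o)%type.

Section Unitization.
Variables (R : realType) (E : truncRieszType R).
Implicit Types (x y z a b c : E) (l m n : R) (u v w : unitization E).
Local Notation T := dtrunc.

Definition ucone u : bool :=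
  ((u.2 == 0) && (0 <= u.1))
  || ((0 < u.2) && fixpt (u.2^-1 *: rneg u.1)).

Definition ule u v : bool := ucone (v - u).

Variant ucone_spec x l : Prop :=
| UCone0 of l = 0 & 0 <= x
| UConePos of 0 < l & T l (rneg x) = rneg x.

Lemma uconeP x l : reflect (ucone_spec x l) (ucone ((x, l) : unitization E)).
Proof.
rewrite /ucone/=; apply: (iffP orP).
  case=> /andP[]; first by move/eqP; left.
  by move=> l0 /(fixptP l0 (rneg_ge0 _)); right.
case=> [-> x0|l0 h]; [left|right]; first by rewrite eqxx.
by rewrite l0; apply/(fixptP l0 (rneg_ge0 _)).
Qed.

Lemma uconeI x l a : 0 < l -> 0 <= a -> T l a = a -> - x <= a ->
  ucone ((x, l) : unitization E).
Proof.
move=> l0 a0 Ta xa; apply/uconeP; right => //.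
by apply: dtrunc_solid Ta => //; [exact: rneg_ge0 | rewrite rneg_leP xa].
Qed.

Lemma rneg_geN x : - x <= rneg x. Proof. exact: rleUl. Qed.

Lemma uconeD u v : ucone u -> ucone v -> ucone (u + v).
Proof.
case: u v => [x l] [y m] /uconeP hx /uconeP hy.
have -> : ((x, l) : unitization E) + (y, m) = (x + y, l + m) by [].
case: hx hy => [-> x0|l0 hx] [-> y0|m0 hy].
- by apply/uconeP; left; rewrite ?addr0 ?raddr_ge0.
- rewrite add0r; apply: (@uconeI _ _ (rneg y)) => //; first exact: rneg_ge0.
  apply: le_trans (rneg_geN y).
  by rewrite rlerN2 -{1}[y]add0r rlerD2r.
- rewrite addr0; apply: (@uconeI _ _ (rneg x)) => //; first exact: rneg_ge0.
  apply: le_trans (rneg_geN x).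
  by rewrite rlerN2 -{1}[x]addr0 rlerD2l.
- apply: (@uconeI _ _ (rneg x + rneg y)); first exact: addr_gt0.
  + by rewrite raddr_ge0 ?rneg_ge0.
  + by apply: dtruncD; rewrite ?rneg_ge0.
  + by rewrite opprD; apply: rlerD; exact: rneg_geN.
Qed.

Lemma ucone0 : ucone 0.
Proof. by apply/uconeP; left. Qed.

Lemma ucone_anti u : ucone u -> ucone (- u) -> u = 0.
Proof.
case: u => [x l] /uconeP hx.
have -> : - ((x, l) : unitization E) = (- x, - l) by [].
move=> /uconeP hN; case: hx hN => [-> x0|l0 _] [/eqP hl x0'|hl _].
- by congr (_, _); apply/le_anti; rewrite x0 andbT -[x]opprK roppr_le0.
- by move: hl; rewrite oppr0 ltxx.
- by move: l0; rewrite oppr_eq0 in hl; rewrite (eqP hl) ltxx.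
- by move: hl; rewrite oppr_gt0 => /(lt_trans l0); rewrite ltxx.
Qed.

Lemma uconeZ (k : R) u : 0 <= k -> ucone u -> ucone (k *: u).
Proof.
rewrite le_eqVlt => /predU1P[<- _|k0]; first by rewrite scale0r ucone0.
case: u => [x l] /uconeP hx.
have -> : k *: ((x, l) : unitization E) = (k *: x, k * l) by [].
case: hx => [-> x0|l0 hx].
  by apply/uconeP; left; rewrite ?mulr0 ?riesz_scaler_ge0// ltW.
have kx : k *: rneg x = (k * l / l) *: rneg x by rewrite mulfK ?gt_eqF.
apply: (@uconeI _ _ (k *: rneg x)); first exact: mulr_gt0.
- by rewrite riesz_scaler_ge0 ?rneg_ge0// ltW.
- by rewrite kx dtruncZ// mulr_gt0.
- by rewrite -scalerN rlerZ_pos ?rneg_geN.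
Qed.

Lemma ule_refl : reflexive ule.
Proof. by move=> u; rewrite /ule subrr ucone0. Qed.

Lemma ule_anti : antisymmetric ule.
Proof.
move=> u v /andP[uv vu]; apply/esym/eqP; rewrite -subr_eq0; apply/eqP.
by apply: ucone_anti; rewrite // opprB.
Qed.

Lemma ule_trans : transitive ule.
Proof.
by move=> v u w uv vw; rewrite /ule -(subrKA v); exact: uconeD.
Qed.

(* Positive part of x + l for l > 0: since (x + l)^- = x^- - x^- /\ l,        *)
(* (x + l)^+ = (x^+ - x^- /\ l) + l, where x^- /\ l = l trunc (x^- / l).      *)
Definition upos0 u : unitization E :=
  (u.1 + rneg u.1 - T u.2 (rneg u.1), u.2).

Definition upos u : unitization E :=
  if 0 < u.2 then upos0 u
  else if u.2 == 0 then (u.1 + rneg u.1, 0) else u + upos0 (- u).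

Lemma upos0_spec v w : 0 < v.2 ->
  ucone (w - upos0 v) = ucone (w - v) && ucone w.
Proof.
case: v w => [x l] [y m] /= l0; rewrite /upos0/=.
set t := T l (rneg x).
have t0 : 0 <= t by exact/dtrunc_ge0/rneg_ge0.
have tx : t <= rneg x by exact/dtrunc_le/rneg_ge0.
have c0 : ucone ((x + rneg x - t, l) : unitization E).
  apply: (@uconeI _ _ t) => //; first exact/dtrunc_id/rneg_ge0.
  by rewrite opprB -[X in _ <= X]subr0 rlerD2l rlerN2 rpos_ge0.
have c1 : ucone (((x + rneg x - t, l) : unitization E) - (x, l)).
  have -> : ((x + rneg x - t, l) : unitization E) - (x, l) = (rneg x - t, 0).
    by congr (_, _); rewrite /= ?subrr// addrAC [x + _]addrC addrK.
  by apply/uconeP; left; rewrite ?rsubr_ge0.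
apply/idP/andP => [h|[]].
  split; last by rewrite -[w in ucone w](subrK (x + rneg x - t, l)) uconeD.
  by have := uconeD h c1; rewrite subrKA.
have E1 : ((y, m) : unitization E) - (x, l) = (y - x, m - l) by [].
rewrite E1.
have -> : ((y, m) : unitization E) - (x + rneg x - t, l) =
   (y - (x + rneg x - t), m - l) by [].
move=> /uconeP h1 /uconeP h2.
case: h1 => [/eqP ml xy|ml hc].
  rewrite subr_eq0 in ml; rewrite (eqP ml) subrr; apply/uconeP; left => //.
  rewrite (eqP ml) in h2; case: h2 => [l00|_ hb].
    by move: l0; rewrite l00 ltxx.
  rewrite rsubr_ge0 in xy; rewrite rsubr_ge0 rlerBlDr.
  have yt : rneg y <= t.
    apply: dtrunc_max => //; rewrite ?rneg_ge0// rneg_leP rneg_ge0 andbT.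
    by apply: (@le_trans _ _ (- x)); [rewrite rlerN2 | exact: rneg_geN].
  apply: (@le_trans _ _ (y + rneg y)); last by rewrite rlerD2l.
  rewrite rpos_leP rpos_ge0 andbT (le_trans xy)//.
  by rewrite -{1}[y]addr0 rlerD2l rneg_ge0.
have lm : l < m by rewrite -subr_gt0.
case: h2 => [m0|m0 hb]; first by move: (lt_trans l0 lm); rewrite m0 ltxx.
set b := rneg y in hb *; set c := rneg (y - x) in hc *.
have b0 : 0 <= b by exact: rneg_ge0.
have c0' : 0 <= c by exact: rneg_ge0.
have bT0 : 0 <= b - T l b by rewrite rsubr_ge0 dtrunc_le.
set a := rjoin (b - T l b) c.
have a0 : 0 <= a by apply: le_trans c0' _; exact: rleUr.
have ca : c <= a by exact: rleUr.
apply: (@uconeI _ _ a) => //.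
  apply: dtrunc_join => //.
  by apply: dtruncB => //; rewrite addrC subrK.
have bax : b - a <= t.
  apply: le_trans (dtrunc_meet l0 (rneg_ge0 x) b0).
  rewrite rlexI !rlerBlDr; apply/andP; split.
    apply: (@le_trans _ _ (rneg x + c)); last by rewrite rlerD2l.
    rewrite rneg_leP raddr_ge0 ?rneg_ge0// andbT.
    have -> : - y = - x + - (y - x) by rewrite opprB addrA addNr add0r.
    by apply: rlerD; exact: rneg_geN.
  by rewrite addrC -rlerBlDr rleUl.
rewrite opprB !rlerBlDr rpos_leP; apply/andP; split.
  rewrite -[X in X <= _]addr0; apply: rlerD => //.
  rewrite -rlerBlDr -opprB; exact: le_trans (rneg_geN _) ca.
rewrite -(rlerD2r (- y) 0) add0r addrAC addrK addrC.
by apply: (le_trans (rneg_geN y)); rewrite -rlerBlDr.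
Qed.

Lemma upos_spec v w : ucone (w - upos v) = ucone (w - v) && ucone w.
Proof.
rewrite /upos; case: ifP => [v0|/negbT]; first exact: upos0_spec.
rewrite -leNgt le_eqVlt; case: ifPn => [/eqP v0 _|v0] /=; last first.
  move=> vlt; rewrite opprD addrA upos0_spec; last by rewrite /= oppr_gt0.
  by rewrite opprK subrK andbC.
case: v w v0 => [x l] [y m] /= ->.
have -> : ((y, m) : unitization E) - (x + rneg x, 0) = (y - (x + rneg x), m).
  by congr (_, _); rewrite /= subr0.
have -> : ((y, m) : unitization E) - (x, 0) = (y - x, m).
  by congr (_, _); rewrite /= subr0.
apply/idP/andP => [h|[]].
  have hx : ucone ((rneg x, 0) : unitization E).
    by apply/uconeP; left; rewrite ?rneg_ge0.
  have hp : ucone ((x + rneg x, 0) : unitization E).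
    by apply/uconeP; left; rewrite ?rpos_ge0.
  split.
    have := uconeD h hx; congr ucone; congr (_, _) => /=; last by rewrite addr0.
    by rewrite opprD addrA subrK.
  have := uconeD h hp; congr ucone; congr (_, _) => /=; last by rewrite addr0.
  by rewrite subrK.
move=> /uconeP h1 /uconeP h2.
case: h2 h1 => [-> y0|m0 hb] [m00 yx|m0' hc].
- by apply/uconeP; left => //; rewrite rsubr_ge0 rpos_leP y0 -rsubr_ge0 yx.
- by rewrite ltxx in m0'.
- by rewrite m00 ltxx in m0.
- apply: (@uconeI _ _ (rjoin (rneg y) (rneg (y - x)))) => //.
  + by apply: le_trans (rneg_ge0 y) _; exact: rleUl.
  + by apply: dtrunc_join; rewrite ?rneg_ge0.
  rewrite opprB rlerBlDr rpos_leP -rlerBlDr -opprB.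
  rewrite (le_trans (rneg_geN _) (rleUr _ _))/=.
  by rewrite -rlerBlDr sub0r (le_trans (rneg_geN _) (rleUl _ _)).
Qed.

Definition ujoin u v : unitization E := u + upos (v - u).
Definition umeet u v : unitization E := - ujoin (- u) (- v).

Lemma uleUx u v w : ule (ujoin u v) w = ule u w && ule v w.
Proof.
by rewrite /ule /ujoin opprD addrA upos_spec opprB addrA subrK andbC.
Qed.

Lemma ulexI u v w : ule u (umeet v w) = ule u v && ule u w.
Proof.
have uleN (p q : unitization E) : ule p q = ule (- q) (- p).
  by rewrite /ule opprK addrC.
by rewrite uleN /umeet opprK uleUx -!uleN.
Qed.

Lemma ule_add w u v : ule u v -> ule (u + w) (v + w).
Proof. by rewrite /ule opprD addrACA subrr addr0. Qed.

Lemma ule_scale (k : R) u : 0 <= k -> ule 0 u -> ule 0 (k *: u).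
Proof. by rewrite /ule !subr0; exact: uconeZ. Qed.

HB.instance Definition _ :=
  Order.Le_isPOrder.Build ring_display (unitization E)
    ule_refl ule_anti ule_trans.

HB.instance Definition _ :=
  Lmodule_POrder_isRiesz.Build R (unitization E)
    ulexI uleUx ule_add ule_scale.

End Unitization.

(* Main.v *)
(* The scalar part is a lattice homomorphism, so in a disjoint family of the
   unitization at most one member has a nonzero scalar part; the others lie in
   the ideal E, which gives (1).  If u is a truncation unit and (s, m) is the
   supremum of a family of E with m > 0, then s + m u is a smaller upper bound,
   a contradiction, so the supremum lies in E.

   Conversely, let E be laterally complete with E + R Archimedean.  The supremum
   w of a maximal disjoint family is a weak unit of E.  The truncation unit is
   the projection of 1 onto the band of w, namely the supremum of
   psi_k = (2^k w - 1)^+ /\ 1, which lies in E.  It exists by lateral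
   completeness alone: since psi_(k+1) = 1 wherever psi_k <> 0, the increments
   psi_k - psi_(k-1) of even index are disjoint, and so are those of odd index,
   so the supremum is the sum of two suprema of disjoint families. *)

Require Import Defs.
From mathcomp Require Import all_boot all_order all_algebra.
From mathcomp Require Import boolp classical_sets reals.

Set Implicit Arguments.
Unset Strict Implicit.
Unset Printing Implicit Defensive.

Import Order.TTheory GRing.Theory Num.Theory.
Local Open Scope ring_scope.

(** * Disjoint elements, suprema of families and weak units *)

Section RieszFacts.
Variables (R : realType) (E : rieszType R).
Implicit Types (x y a b r s : E).

Lemma rmeetC x y : rmeet x y = rmeet y x.
Proof. by apply/le_anti; rewrite !rlexI !rleIl !rleIr. Qed.

Lemma rmeet0r x : 0 <= x -> rmeet 0 x = 0.
Proof. by move=> x0; apply/le_anti; rewrite rleIl rlexI lexx. Qed.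

Lemma rlerMn x y n : x <= y -> x *+ n <= y *+ n.
Proof. by move=> xy; elim: n => // n IHn; rewrite !mulrS rlerD. Qed.

Lemma rmuln_ge0 x n : 0 <= x -> 0 <= x *+ n.
Proof. by move=> /(rlerMn n); rewrite mul0rn. Qed.

Lemma rdisj_le a b x y : 0 <= a -> 0 <= b -> a <= x -> b <= y ->
  rmeet x y = 0 -> rmeet a b = 0.
Proof.
move=> a0 b0 ax bx xy; apply/le_anti; rewrite rlexI a0 b0 andbT -xy rlexI.
by rewrite (le_trans (rleIl _ _) ax) (le_trans (rleIr _ _) bx).
Qed.

(** [a + b - s] lies below both [a] and [b], hence below their meet. *)
Lemma rdisj_addr_le a b s : rmeet a b = 0 -> a <= s -> b <= s -> a + b <= s.
Proof.
move=> ab0 as_ bs; rewrite -[s]add0r -rlerBlDr -ab0 rlexI.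
by rewrite !rlerBlDr rlerD2l bs addrC rlerD2l.
Qed.

Lemma rdisj_sum (x : nat -> E) r n : (forall i, 0 <= x i) -> 0 <= r ->
  (forall i, (i < n)%N -> rmeet (x i) r = 0) ->
  0 <= \sum_(i < n) x i /\ rmeet (\sum_(i < n) x i) r = 0.
Proof.
move=> x0 r0; elim: n => [|n IHn] xr; first by rewrite big_ord0 rmeet0r.
have [|s0 sr] := IHn; first by move=> i /ltnW; exact: xr.
rewrite big_ord_recr/=; split; first exact: raddr_ge0.
by apply: rdisjD => //; exact: xr.
Qed.

Lemma rdisj_sum_le (x : nat -> E) s n : (forall i, 0 <= x i) ->
  (forall i j, i <> j -> rmeet (x i) (x j) = 0) ->
  (forall i, x i <= s) -> \sum_(i < n) x i <= s.
Proof.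
move=> x0 xx xs; elim: n => [|n IHn].
  by rewrite big_ord0 (le_trans (x0 0%N)).
rewrite big_ord_recr/=; apply: rdisj_addr_le => //.
apply: (rdisj_sum _ _ _).2 => // i ltin; apply: xx => ein.
by rewrite ein ltnn in ltin.
Qed.

Lemma supremumsP (I : Type) (x : I -> E) s :
  supremums (range x) s <->
  (forall i, x i <= s) /\ (forall y, (forall i, x i <= y) -> s <= y).
Proof.
split=> [[ub lb]|[ub lb]]; split.
- by move=> i; apply: ub; exists i.
- by move=> y xy; apply: lb => _ [i _ <-].
- by move=> _ [i _ <-].
- by move=> y xy; apply: lb => i; apply: xy; exists i.
Qed.

Lemma laterally_complete_weak_unit : laterally_complete E ->
  exists2 w : E, 0 <= w & forall y, 0 <= y -> rmeet y w = 0 -> y = 0.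
Proof.
move=> lc.
pose P (A : set E) := (forall a, A a -> 0 <= a) /\
  (forall a b, A a -> A b -> a <> b -> rmeet a b = 0).
have [|A [[A0 Ad] Amax]] := @Zorn_bigcup E P.
  move=> F FP Ftot; split=> [a [X FX Xa]|a b [X FX Xa] [Y FY Yb]].
    exact: (FP X FX).1.
  have [XY|YX] := Ftot _ _ FX FY.
    by apply: (FP Y FY).2 => //; exact: XY.
  by apply: (FP X FX).2 => //; exact: YX.
(* Adjoining 0 makes the index type inhabited even when [A] is empty. *)
pose I := {a : E | a = 0 \/ A a}.
have I_inj (i j : I) : sval i = sval j -> i = j.
  by case: i j => [a pa] [b pb] /= eab; exact: eq_exist.
have I0 (i : I) : 0 <= sval i by case: i => a /= [->|/A0].
have [|||w /supremumsP[wub _]] := lc I sval.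
- by constructor; exists 0; left.
- exact: I0.
- move=> i j ij; have [i0|Ai] := svalP i; first by rewrite i0 rmeet0r.
  have [j0|Aj] := svalP j; first by rewrite j0 rmeetC rmeet0r.
  by apply: Ad => // /I_inj.
have w0 : 0 <= w by have := wub (exist _ 0 (or_introl erefl)).
exists w => // y y0 yw.
(* An element disjoint from [w] is disjoint from all of [A]; by maximality it belongs to [A], so it
   is disjoint from itself. *)
have Ay a : A a -> rmeet y a = 0.
  move=> Aa; apply: rdisj_le yw => //; first exact: A0.
  exact: (wub (exist _ a (or_intror Aa))).
have yA : A y.
  apply: contrapT => nAy; apply: (Amax (fun a => A a \/ a = y)); last first.
    split=> [a [/A0//|->//]|a b [Aa|->] [Ab|->]// ab]; first exact: Ad.
    - by rewrite rmeetC Ay.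
    - exact: Ay.
  split; last by move=> /(_ y); apply: contra_not nAy => /(_ (or_intror erefl)).
  by move=> a; left.
by rewrite -(Ay y yA); apply/le_anti; rewrite rlexI lexx rleIl.
Qed.

End RieszFacts.

(** * Truncated multiples, read as functions cut off at 1 *)

Section Unit.
Variables (R : realType) (E : truncRieszType R).
Implicit Types (x y z a b r w : E).

Lemma dtrunc1 x : dtrunc 1 x = trunc x.
Proof. by rewrite /dtrunc invr1 !scale1r. Qed.

Lemma trunc_le a : 0 <= a -> trunc a <= a.
Proof. by move=> a0; rewrite -dtrunc1 dtrunc_le. Qed.

Lemma truncK a : 0 <= a -> trunc (trunc a) = trunc a.
Proof. by move=> a0; have := dtrunc_id ltr01 a0; rewrite !dtrunc1. Qed.

Lemma trunc_max a z : 0 <= a -> 0 <= z -> z <= a -> trunc z = z -> z <= trunc a.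
Proof.
by move=> a0 z0 za tz; rewrite -dtrunc1 dtrunc_max// dtrunc1.
Qed.

Lemma trunc_solid a b : 0 <= a -> a <= b -> trunc b = b -> trunc a = a.
Proof. by rewrite -!dtrunc1; exact: dtrunc_solid. Qed.

(* The function [(t - 1)^+ /\ 1]. *)
Definition ramp a : E := trunc (a - trunc a).

Lemma subr_trunc_ge0 a : 0 <= a -> 0 <= a - trunc a.
Proof. by move=> a0; rewrite rsubr_ge0 trunc_le. Qed.

Lemma ramp_ge0 a : 0 <= a -> 0 <= ramp a.
Proof. by move=> a0; rewrite trunc_ge0// subr_trunc_ge0. Qed.

Lemma ramp_fix a : 0 <= a -> trunc (ramp a) = ramp a.
Proof. by move=> a0; rewrite truncK// subr_trunc_ge0. Qed.

Lemma ramp_le a : 0 <= a -> ramp a <= a - trunc a.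
Proof. by move=> a0; rewrite trunc_le// subr_trunc_ge0. Qed.

(* [2 (a - 1)^+ <= ((2a - 1)^+ - 1)^+] *)
Lemma subr_trunc_double a : 0 <= a ->
  (a - trunc a) *+ 2 <=
  (a *+ 2 - trunc (a *+ 2)) - trunc (a *+ 2 - trunc (a *+ 2)).
Proof.
move=> a0; have c0 : 0 <= a *+ 2 by exact: raddr_ge0.
set c := a *+ 2 in c0 *; set d := c - trunc c.
have d0 : 0 <= d by exact: subr_trunc_ge0.
have t0 : 0 <= trunc c by exact: trunc_ge0.
have td0 : 0 <= trunc d by exact: trunc_ge0.
(* The claim amounts to [trunc c + trunc d <= dtrunc (1 + 1) c], and a sum of two elements fixed at
   level 1 is fixed at level 2. *)
have T2 : dtrunc (1 + 1) c = trunc a *+ 2.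
  rewrite /dtrunc /c -[1 + 1]/(2%:R) -scaler_nat scalerA mulVf ?pnatr_eq0//.
  by rewrite scale1r scaler_nat.
rewrite mulrnBl -/c {1}/d -[X in _ <= X]addrA rlerD2l -opprD rlerN2 -T2.
apply: dtrunc_max => //; [exact: addr_gt0|exact: raddr_ge0| |].
  by rewrite addrC -[trunc c]opprK rlerBlDr trunc_le.
by apply: dtruncD => //; rewrite dtrunc1 truncK.
Qed.

Lemma subr_trunc_le_double a : 0 <= a ->
  a - trunc a <=
  (a *+ 2 - trunc (a *+ 2)) - trunc (a *+ 2 - trunc (a *+ 2)).
Proof.
move=> a0; apply: le_trans (subr_trunc_double a0).
by rewrite -[X in X <= _]addr0 mulr2n rlerD2l subr_trunc_ge0.
Qed.

Lemma ramp_le_double a : 0 <= a -> ramp a <= ramp (a *+ 2).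
Proof.
move=> a0; have c0 : 0 <= a *+ 2 by exact: raddr_ge0.
apply: trunc_max; rewrite ?subr_trunc_ge0 ?ramp_ge0 ?ramp_fix//.
apply: le_trans (ramp_le a0) _; apply: le_trans (subr_trunc_le_double a0) _.
by rewrite rlerBlDr -[X in X <= _]addr0 rlerD2l ramp_ge0.
Qed.

(* [ramp (2 a)] equals 1 wherever [ramp a] does not vanish. *)
Lemma ramp_double_disj a z : 0 <= a -> 0 <= z -> trunc z = z ->
  rmeet (ramp a) (rjoin (z - ramp (a *+ 2)) 0) = 0.
Proof.
move=> a0 z0 tz; have c0 : 0 <= a *+ 2 by exact: raddr_ge0.
have Tz : dtrunc 1 z = z by rewrite dtrunc1.
(* For [d = c - trunc c] with [c = a *+ 2], the positive part of [z - trunc d] is disjoint from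
   [d - trunc d], which dominates [ramp a]. *)
have := dtrunc_disj ltr01 (subr_trunc_ge0 c0) z0 Tz; rewrite dtrunc1 rmeetC.
apply: rdisj_le => //; [exact: ramp_ge0|exact: rleUr|].
exact: le_trans (ramp_le a0) (subr_trunc_le_double a0).
Qed.

(** Positive elements below a fixed point are fixed and [n <= 2 ^ n], so every [a *+ n] is fixed,
    that is, lies below 1 in the unitization. *)
Lemma arch_trunc_pow2_eq0 a : riesz_archimedean (unitization E) -> 0 <= a ->
  (forall k, trunc (a *+ 2 ^ k) = a *+ 2 ^ k) -> a = 0.
Proof.
move=> arch a0 fix_a.
have an0 n : 0 <= a *+ n by exact: rmuln_ge0.
have fix_n n : trunc (a *+ n) = a *+ n.
  apply: trunc_solid (fix_a n) => //.
  rewrite -(subnKC (ltnW (ltn_expl n (ltnSn 1)))) mulrnDr.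
  by rewrite -[X in X <= _]addr0 rlerD2l.
suff /(congr1 fst) : ((a, 0) : unitization E) = 0 by [].
apply: (arch _ ((0, 1) : unitization E)).
- change (ucone (((a, 0) : unitization E) - 0)).
  by rewrite subr0; apply/uconeP; left.
- change (ucone (((0, 1) : unitization E) - 0)).
  rewrite subr0; apply: (@uconeI _ _ _ _ 0) => //; last by rewrite oppr0.
  by have := fix_n 0%N; rewrite dtrunc1.
- move=> n; change (ucone (((0, 1) : unitization E) - (a, 0) *+ n)).
  have -> : ((a, 0) : unitization E) *+ n = (a *+ n, 0).
    by elim: n => // n IHn; rewrite mulrS IHn mulrS; congr (_, _); rewrite /= addr0.
  have -> : ((0, 1) : unitization E) - (a *+ n, 0) = (- (a *+ n), 1).
    by congr (_, _); rewrite /= ?sub0r ?subr0.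
  by apply: (@uconeI _ _ _ _ (a *+ n)); rewrite ?dtrunc1 ?opprK.
Qed.

(** * The increasing sequence of ramps of [w *+ 2 ^ k] and its supremum *)

Section RampSequence.
Variable (w : E).
Hypothesis w0 : 0 <= w.

Definition rampseq k : E := ramp (w *+ 2 ^ k).

Definition rampdiff k : E :=
  if k is j.+1 then rampseq j.+1 - rampseq j else rampseq 0.

Lemma rampseq_ge0 k : 0 <= rampseq k.
Proof. exact/ramp_ge0/rmuln_ge0. Qed.

Lemma rampseq_fix k : trunc (rampseq k) = rampseq k.
Proof. exact/ramp_fix/rmuln_ge0. Qed.

Lemma rampseqS k : rampseq k.+1 = ramp (w *+ 2 ^ k *+ 2).
Proof. by rewrite /rampseq expnSr mulrnA. Qed.

Lemma rampseq_leS k : rampseq k <= rampseq k.+1.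
Proof. rewrite rampseqS; exact/ramp_le_double/rmuln_ge0. Qed.

Lemma rampseq_le j k : (j <= k)%N -> rampseq j <= rampseq k.
Proof.
move=> /subnKC <-; elim: (k - j)%N => [|n IHn]; first by rewrite addn0.
by rewrite addnS (le_trans IHn)// rampseq_leS.
Qed.

Lemma rampseq_disj k z : 0 <= z -> trunc z = z ->
  rmeet (rampseq k) (rjoin (z - rampseq k.+1) 0) = 0.
Proof. by move=> z0 tz; rewrite rampseqS ramp_double_disj// rmuln_ge0. Qed.

Lemma rampdiff_ge0 k : 0 <= rampdiff k.
Proof.
by case: k => [|k]; rewrite /rampdiff ?rampseq_ge0// rsubr_ge0 rampseq_leS.
Qed.

Lemma rampdiff_le k : rampdiff k <= rampseq k.
Proof.
case: k => [|k] /=; first exact: lexx.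
by rewrite rlerBlDr -[X in X <= _]addr0 rlerD2l rampseq_ge0.
Qed.

(** Since [rampseq j.+1] is already 1 on the support of [rampseq j], later increments vanish there.
    Consecutive increments may overlap, hence the gap of two. *)
Lemma rampdiff_disj j k : (j.+1 < k)%N -> rmeet (rampdiff j) (rampdiff k) = 0.
Proof.
case: k => // k; rewrite ltnS => jk.
apply: rdisj_le (rampseq_disj j (rampseq_ge0 k.+1) (rampseq_fix _)).
- exact: rampdiff_ge0.
- exact: rampdiff_ge0.
- exact: rampdiff_le.
- by apply: le_trans (rleUl _ _); rewrite /= rlerD2l rlerN2 rampseq_le.
Qed.

Lemma rampdiffD_le j k : (j < k)%N -> rampdiff j + rampdiff k <= rampseq k.
Proof.
case: k => // k; rewrite ltnS => jk /=.
rewrite addrC -[rampdiff j]opprK rlerBlDr rlerD2l rlerN2.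
exact: le_trans (rampdiff_le _) (rampseq_le jk).
Qed.

Lemma rampdiff_disj_double (b i j : nat) : i <> j ->
  rmeet (rampdiff (b + i.*2)) (rampdiff (b + j.*2)) = 0.
Proof.
move=> /eqP; rewrite neq_ltn => /orP[ij|ij]; [|rewrite rmeetC];
  by apply: rampdiff_disj; rewrite -!addnS leq_add2l -doubleS ltn_Sdouble.
Qed.

(** Stopping at an odd index leaves as many even increments as odd ones. *)
Lemma rampseq_sum n : rampseq n.*2.+1 =
  \sum_(i < n.+1) rampdiff (0 + i.*2) + \sum_(i < n.+1) rampdiff (1 + i.*2).
Proof.
elim: n => [|n IHn].
  by rewrite !big_ord_recr !big_ord0 /= !add0r addrC subrK.
rewrite big_ord_recr [X in _ + X]big_ord_recr/= addrACA -IHn doubleS /=.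
by rewrite [X in _ + X]addrC subrKA addrC subrK.
Qed.

Lemma rampseq_sup : laterally_complete E ->
  exists u : E, (forall k, rampseq k <= u) /\
    (forall y, (forall k, rampseq k <= y) -> u <= y).
Proof.
move=> lc.
have fam (b : nat) : exists s : E, supremums (range (fun i => rampdiff (b + i.*2))) s.
  apply: lc; first by constructor; exact: 0%N.
  - by move=> i; exact: rampdiff_ge0.
  - by move=> i j; exact: rampdiff_disj_double.
have [s0 /supremumsP[ub0 lub0]] := fam 0%N.
have [s1 /supremumsP[ub1 lub1]] := fam 1%N.
exists (s0 + s1); split=> [k|y ky].
  have [n kn] : exists n, (k <= n.*2.+1)%N.
    by exists k; rewrite -addnn -addnS leq_addr.
  apply: le_trans (rampseq_le kn) _; rewrite rampseq_sum.
  have sum_le (b : nat) s n' : (forall i, rampdiff (b + i.*2) <= s) ->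
      \sum_(i < n') rampdiff (b + i.*2) <= s.
    apply: (@rdisj_sum_le _ _ (fun i => rampdiff (b + i.*2))) => [i|i j].
      exact: rampdiff_ge0.
    exact: rampdiff_disj_double.
  by apply: rlerD; exact: sum_le.
(* Taking one supremum at a time reduces [s0 + s1 <= y] to a bound on one even plus one odd
   increment. Their indices differ by parity, so [rampdiffD_le] applies in one order or the
   other. *)
rewrite -[s1]opprK rlerBlDr; apply: lub0 => i.
rewrite -rlerBlDr opprK addrC -[rampdiff _]opprK rlerBlDr.
apply: lub1 => j; rewrite -rlerBlDr opprK.
have [ij|] := ltnP (0 + i.*2) (1 + j.*2).
  by rewrite addrC; apply: le_trans (rampdiffD_le ij) _.
rewrite leq_eqVlt => /predU1P[/(congr1 odd)|ji].
  by rewrite add0n add1n /= !odd_double.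
by apply: le_trans (rampdiffD_le ji) _.
Qed.

End RampSequence.

(** * A truncation unit from lateral completeness *)

Lemma laterally_complete_unital :
  riesz_archimedean (unitization E) -> laterally_complete E -> unital E.
Proof.
move=> arch lc; have [w w0 wunit] := laterally_complete_weak_unit lc.
have [u [ub lub]] := rampseq_sup w0 lc.
have u0 : 0 <= u by apply: le_trans (rampseq_ge0 w0 0) (ub 0%N).
(* The ramps are fixed points below [u], so [trunc u] still bounds them. *)
have tu : trunc u = u.
  apply/le_anti; rewrite trunc_le//=; apply: lub => k.
  by apply: trunc_max; rewrite ?rampseq_ge0 ?rampseq_fix.
exists u => // x x0; apply/le_anti; rewrite rlexI trunc_le//=.
have xu : rmeet x u <= trunc x.
  by have /andP[] := trunc_meet _ _ x0 u0; rewrite tu.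
rewrite xu andbT; set z := trunc x.
have z0 : 0 <= z by exact: trunc_ge0.
have tz : trunc z = z by exact: truncK.
(* [r] is the excess of [trunc x] over [u]. It is disjoint from every ramp, and it vanishes once its
   meet with the weak unit [w] does. *)
set r := rjoin (z - u) 0; have r0 : 0 <= r by exact: rleUr.
have rz : r <= z.
  by rewrite rleUx z0 rlerBlDr -[X in X <= _]addr0 rlerD2l u0.
have tr : trunc r = r by exact: trunc_solid tz.
suff r_eq0 : r = 0.
  by rewrite -[u]add0r -rlerBlDr -r_eq0 rleUl.
have r_ramp k : rmeet r (rampseq w k) = 0.
  rewrite rmeetC; apply: rdisj_le (rampseq_disj w0 k z0 tz) => //.
  - exact: rampseq_ge0.
  - rewrite rleUx rleUr andbT; apply: le_trans (rleUl _ _).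
    by rewrite rlerD2l rlerN2 ub.
apply: wunit => //; apply: arch_trunc_pow2_eq0 => //; first by rewrite rlexI r0.
move=> k; set g := rmeet r w; set c := w *+ 2 ^ k.
have c0 : 0 <= c by exact: rmuln_ge0.
have g0 : 0 <= g by rewrite rlexI r0.
(* This meet is a fixed point because [r] is, so it lies below [trunc (c - trunc c)], the ramp of
   index [k], which is disjoint from [r]. *)
have rc : rmeet r (c - trunc c) = 0.
  have q0 : 0 <= rmeet r (c - trunc c) by rewrite rlexI r0 subr_trunc_ge0.
  apply/le_anti; rewrite q0 andbT -(r_ramp k) rlexI rleIl.
  apply: trunc_max => //; [exact: subr_trunc_ge0|exact: rleIr|].
  by apply: trunc_solid tr => //; exact: rleIl.
have rnc : rmeet (r *+ 2 ^ k) (c - trunc c) = 0.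
  have := @rdisj_sum _ E (fun=> r) (c - trunc c) (2 ^ k).
  rewrite sumr_const card_ord => h.
  by apply: (h _ _ _).2 => //; exact: subr_trunc_ge0.
apply: (@trunc_solid _ (trunc c)); first exact: rmuln_ge0; last exact: truncK.
(* [g *+ 2 ^ k - trunc c] lies below both [r *+ 2 ^ k] and [c - trunc c], hence below 0; so
   [g *+ 2 ^ k] lies below the fixed point [trunc c]. *)
rewrite -[trunc c]add0r -rlerBlDr -rnc rlexI; apply/andP; split.
  rewrite rlerBlDr; apply: (@le_trans _ _ (r *+ 2 ^ k)).
    by apply: rlerMn; exact: rleIl.
  by rewrite -[X in X <= _]addr0 rlerD2l trunc_ge0.
by rewrite rlerD2r; apply: rlerMn; exact: rleIr.
Qed.

End Unit.

(** * The ideal [E] in its unitization, and transfer of lateral completeness *)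

Section UnitizationOrder.
Variables (R : realType) (E : truncRieszType R).
Implicit Types (x y a b : E) (u v w : unitization E).

Lemma leuE u v : (u <= v) = ucone (v - u). Proof. by []. Qed.

Lemma leu_snd u v : u <= v -> u.2 <= v.2.
Proof.
rewrite leuE /ucone/= -subr_ge0 => /orP[/andP[/eqP->]|/andP[/ltW]]//.
Qed.

Lemma leu_inl a b : (((a, 0) : unitization E) <= (b, 0)) = (a <= b).
Proof. by rewrite leuE /ucone/= subr0 eqxx ltxx orbF rsubr_ge0. Qed.

Lemma geu0_inl a : ((0 : unitization E) <= (a, 0)) = (0 <= a).
Proof. exact: (leu_inl 0 a). Qed.

Lemma leu_inl_inv u a : 0 <= u -> u <= ((a, 0) : unitization E) -> u = (u.1, 0).
Proof.
move=> /leu_snd/= u0 /leu_snd/= u1; case: u u0 u1 => b l /= l0 l1.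
by congr (_, _); apply/le_anti; rewrite l0 l1.
Qed.

Lemma umeet_snd u v : (rmeet u v).2 = Num.min u.2 v.2.
Proof.
have upos_snd w : (upos w).2 = Num.max w.2 0.
  by rewrite /upos; case: ltgtP => //= _; rewrite addrN.
have -> : (rmeet u v).2 = u.2 - (upos (- v - - u)).2.
  by rewrite /rmeet/= /umeet /ujoin /= opprD opprK.
rewrite upos_snd/= opprK [- v.2 + _]addrC.
case: (leP u.2 v.2) => uv; first by rewrite max_r ?subr0// subr_le0.
by rewrite max_l ?subr_ge0 1?ltW// opprB addrC subrK.
Qed.

(** A positive element below [(a, 0)] has scalar part 0, so disjointness means the same in [E] and
    in the unitization. *)
Lemma rmeet_inl a b : 0 <= a -> 0 <= b ->
  (rmeet ((a, 0) : unitization E) (b, 0) = 0) <-> (rmeet a b = 0).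
Proof.
move=> a0 b0; split=> [ab|ab].
  apply/le_anti; rewrite rlexI a0 b0 !andbT -leu_inl.
  change (((rmeet a b, 0) : unitization E) <= 0).
  by rewrite -ab rlexI !leu_inl rleIl rleIr.
set m := rmeet _ _.
have m0 : 0 <= m by rewrite rlexI !geu0_inl a0.
have ma := rleIl ((a, 0) : unitization E) (b, 0); rewrite -/m in ma.
have mb := rleIr ((a, 0) : unitization E) (b, 0); rewrite -/m in mb.
have em := leu_inl_inv m0 ma; rewrite em ?geu0_inl ?leu_inl in m0 ma mb.
rewrite em; congr (_, _); apply/le_anti.
by rewrite m0 -ab rlexI ma mb.
Qed.

(* [E] is an ideal of its unitization, so suprema of positive families agree. *)
Lemma supremums_inl (I : Type) (x : I -> E) s : inhabited I ->
  (forall i, 0 <= x i) -> supremums (range x) s ->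
  supremums (range (fun i => (x i, 0) : unitization E)) ((s, 0) : unitization E).
Proof.
move=> [i0] x0 /supremumsP[ub lub]; apply/supremumsP.
split=> [i|v xv]; first by rewrite leu_inl.
(* The bound [v] may have a nonzero scalar part, but its meet with [(s, 0)] is in [E]. *)
set m := rmeet ((s, 0) : unitization E) v.
have xm i : ((x i, 0) : unitization E) <= m by rewrite rlexI xv leu_inl ub.
have m0 : 0 <= m by apply: le_trans (xm i0); rewrite geu0_inl.
have em := leu_inl_inv m0 (rleIl _ _).
apply: le_trans (rleIr _ _ : m <= v); rewrite em leu_inl; apply: lub => i.
by have := xm i; rewrite em leu_inl.
Qed.

Lemma unitization_laterally_complete :
  laterally_complete E -> laterally_complete (unitization E).
Proof.
move=> lc I x inhI x0 xd.
have x20 i : 0 <= (x i).2 by exact: leu_snd (x0 i).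
have xE i : (x i).2 = 0 -> x i = ((x i).1, 0) by case: (x i) => a l /= ->.
(* Members outside [E] are replaced by 0, which keeps the index type and disjointness. *)
pose y i : E := if (x i).2 == 0 then (x i).1 else 0.
have y0 i : 0 <= y i.
  by rewrite /y; case: eqP => // /xE xi; rewrite -geu0_inl -xi.
have [i j ij|s /(supremums_inl inhI y0)/supremumsP[ub lub]] := lc I y inhI y0.
  have := y0 i; have := y0 j; rewrite /y.
  case: eqP => [/xE xj|_] yj; last by move=> ?; rewrite rmeetC rmeet0r.
  case: eqP => [/xE xi|_] yi; last by rewrite rmeet0r.
  by apply/rmeet_inl => //; rewrite -xi -xj xd.
have [[i0 /eqP xi0]|x2] := pselect (exists i, (x i).2 <> 0); last first.
  have yx i : x i = (y i, 0).
    have /xE xi : (x i).2 = 0 by apply: contrapT => xi; apply: x2; exists i.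
    by rewrite /y {2}xi eqxx.
  by exists (s, 0); apply/supremumsP; split=> [i|v xv];
    rewrite ?yx//; apply: lub => i; rewrite -yx.
exists (rjoin (x i0) (s, 0)); apply/supremumsP; split=> [i|v xv].
  have [->|/xd xi] := pselect (i = i0); first exact: rleUl.
  have xi2 : (x i).2 = 0.
    apply/eqP; apply: contraT => xin0.
    (* Two positive scalar parts would give the meet a positive one. *)
    have := congr1 snd xi; rewrite umeet_snd /= => /eqP.
    by rewrite gt_eqF// lt_min !lt_neqAle !x20 eq_sym xin0 eq_sym xi0.
  apply: le_trans (rleUr _ _); apply: le_trans (ub i).
  by rewrite /y xi2 eqxx -(xE i xi2).
rewrite rleUx xv; apply: lub => i; rewrite /y.
case: eqP => [/xE <-//|_]; exact: le_trans (x0 i) (xv i).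
Qed.

Lemma unital_laterally_complete :
  laterally_complete (unitization E) -> unital E -> laterally_complete E.
Proof.
move=> lc [u u0 uE] I x inhI x0 xd.
have [||[s m] /supremumsP[ub lub]] :=
  lc I (fun i => (x i, 0) : unitization E) inhI.
- by move=> i; rewrite geu0_inl.
- by move=> i j ij; apply/rmeet_inl => //; exact: xd.
have [i0] := inhI.
have m0 : 0 <= m by exact: leu_snd (ub i0).
have [m_eq0|mn0] := eqVneq m 0.
  exists s; apply/supremumsP; rewrite m_eq0 in ub lub; split=> [i|y xy].
    by rewrite -leu_inl.
  by rewrite -leu_inl; apply: lub => i; rewrite leu_inl.
have mp : 0 < m by rewrite lt_neqAle eq_sym mn0.
(* An upper bound with scalar part 0 contradicts the minimality of [(s, m)]. *)
suff /leu_snd/= : ((s, m) : unitization E) <= (s + m *: u, 0).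
  by rewrite leNgt mp.
apply: lub => i; rewrite leu_inl addrC -rlerBlDr.
have := ub i; rewrite leuE.
have -> : ((s, m) : unitization E) - (x i, 0) = (s - x i, m).
  by congr (_, _); rewrite /= subr0.
case/uconeP => [mE|_ hT]; first by rewrite mE eqxx in mn0.
(* The cone condition makes the negative part of [s - x i] a truncation at level [m], hence at most
   [m *: u]. *)
rewrite -[x i - s]opprB; apply: le_trans (rneg_geN _) _; rewrite -hT /dtrunc.
by rewrite rlerZ_pos// uE ?rleIr// invZ_ge0// rneg_ge0.
Qed.

End UnitizationOrder.

Theorem theorem6p2 (R : realType) (E : truncRieszType R) :
  (laterally_complete E -> laterally_complete (unitization E)) /\
  (laterally_complete (unitization E) -> riesz_archimedean (unitization E) ->
   (laterally_complete E <-> unital E)).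
Proof.
split=> [|lcU arch]; first exact: unitization_laterally_complete.
by split; [exact: laterally_complete_unital|exact: unital_laterally_complete].
Qed.
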